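(* There is no $13\times 22$ binary matrix with exactly $138$ ones and no all-one $3\times 3$ submatrix. Consequently, $\mathrm{Z}(13,22,3,3)=137$.
   Context: A submatrix is obtained by choosing any three distinct rows and any three distinct columns (not necessarily consecutive). For positive integers $m,n,s,t$, the Zarankiewicz number $\mathrm{Z}(m,n,s,t)$ is the maximum number of edges in a subgraph of the complete bipartite graph $K_{m,n}$ containing no copy of $K_{s,t}$. In particular $\mathrm{Z}(13,22,3,3)$ is the maximum number of ones in a $13\times 22$ binary matrix having no all-one $3\times 3$ submatrix. *)

(* Defs.v *)
From mathcomp Require Import all_boot all_algebra.
Set Implicit Arguments.
Unset Strict Implicit.
Unset Printing Implicit Defensive.

Definition nb_ones (m n : nat) (A : 'M[bool]_(m, n)) : nat :=
  #|[set ij : 'I_m * 'I_n | A ij.1 ij.2]|.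

(* Injectivity of [f] and [g] says that the chosen rows and columns are
   distinct; they need not be listed in increasing order, which is immaterial
   for an all-one submatrix. *)
Definition has_all_one_submx (s t m n : nat) (A : 'M[bool]_(m, n)) : Prop :=
  exists (f : 'I_s -> 'I_m) (g : 'I_t -> 'I_n),
    [/\ injective f, injective g & mxsub f g A = const_mx true].

(* A subgraph of K_{m,n} is given by its edge set [E]; its vertex set is taken
   to be all of 'I_m + 'I_n, since isolated vertices affect neither the number
   of edges nor the copies of K_{s,t} with s, t > 0. *)
Definition bip_adj (m n : nat) (E : {set 'I_m * 'I_n}) : rel ('I_m + 'I_n) :=
  fun x y => match x, y with
  | inl i, inr j | inr j, inl i => (i, j) \in E
  | _, _ => false
  end.

(* [bip_adj [set: 'I_s * 'I_t]] is the adjacency relation of K_{s,t}. A copy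
   is a not necessarily induced subgraph, and its part of size s may lie on
   either side of K_{m,n}. *)
Definition has_Kst_copy (s t m n : nat) (E : {set 'I_m * 'I_n}) : bool :=
  [exists f : {ffun 'I_s + 'I_t -> 'I_m + 'I_n},
     injectiveb f &&
     [forall x, forall y,
        bip_adj [set: 'I_s * 'I_t] x y ==> bip_adj E (f x) (f y)]].

(* For s, t > 0 the empty edge set has no copy of K_{s,t}, so this is a
   maximum over a nonempty family. *)
Definition zarankiewicz (m n s t : nat) : nat :=
  \max_(E : {set 'I_m * 'I_n} | ~~ has_Kst_copy s t E) #|E|.

(* Main.v *)
Require Import Defs.
From mathcomp Require Import all_boot all_algebra zify.
Set Implicit Arguments.
Unset Strict Implicit.
Unset Printing Implicit Defensive.

(* Count triples of rows: each lies in at most two columns. Giving a column of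
   size [k] the weight [w (k - 1)] for each of its rows, where [4 * comb (b, 2)]
   majorizes [w b] with equality for [b = 5, 6], 138 ones force the total weight
   of the rows to be at least [13 * 480 + 120]. The columns through a row induce
   on the other 12 rows blocks of size [b = k - 1] covering every pair at most
   twice; such a packing has weight at most 480 unless it is a biplane on 11
   points with the 12th point added to three of its blocks, of weight 500. So at
   least six rows are of this special kind, each with a partner row, its 12th
   point. Special rows with different partners are too few; if all have the
   same partner then every other row is special and the partner lies in exactly
   six columns; any two of these share 0 or 3 other rows, and two that share 3
   turn out to have the same disjoint column, although each has only one. *)

(** * Packings of pairs of 12 points *)

(* [(x - m) * (x - m - 1)], which is nonnegative on the integers; one of the
   two truncated products vanishes *)
Definition gap (m x : nat) : nat := (m - x) * (m.+1 - x) + (x - m) * (x - m.+1).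

Lemma gapE m x : gap m x + (2 * m + 1) * x = x * x + m * m.+1.
Proof.
rewrite /gap; case: (leqP x m) => h.
  have -> : x - m = 0 by lia.
  have [d ->] : exists d, m = x + d by exists (m - x); lia.
  have -> : x + d - x = d by lia.
  have -> : (x + d).+1 - x = d.+1 by lia.
  nia.
have -> : m - x = 0 by lia.
have [d ->] : exists d, x = m.+1 + d by exists (x - m.+1); lia.
have -> : m.+1 + d - m = d.+1 by lia.
have -> : m.+1 + d - m.+1 = d by lia.
nia.
Qed.

(* At most [4 * comb (k, 2)], and large enough for [weight_line], where equality
   holds at the column sizes 6 and 7 of a balanced matrix with 138 ones. *)
Definition weight (k : nat) : nat :=
  nth 0 [:: 0; 0; 0; 0; 12; 40; 60; 75; 87; 96; 104; 110; 116] k.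

Lemma weight_le k : weight k <= 2 * (k * k.-1).
Proof. by do 13?[case: k => [//|k]]; rewrite /weight nth_default. Qed.

Lemma weight_line k : k <= 13 -> 180 * k <= k * weight k.-1 + 840.
Proof. by do 14?[case: k => [//|k]]. Qed.

Definition block_sizes : seq nat := [:: 12; 11; 10; 9; 8; 7; 6; 5; 4].

Fixpoint configs (ks : seq nat) (budget need : nat) : seq (seq nat) :=
  if 2 * budget < need then [::] else
  if ks is k :: ks' then
    flatten [seq [seq n :: s | s <- configs ks' (budget - n * (k * k.-1))
                                                (need - n * weight k)]
            | n <- iota 0 (budget %/ (k * k.-1)).+1]
  else if need == 0 then [:: [::]] else [::].

Lemma mem_configs (N : nat -> nat) ks budget need :
  all (leq 2) ks ->
  \sum_(k <- ks) N k * (k * k.-1) <= budget ->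
  need <= \sum_(k <- ks) N k * weight k ->
  map N ks \in configs ks budget need.
Proof.
elim: ks budget need => [|k ks IH] budget need.
  by rewrite !big_nil /= leqn0 => _ _ /eqP->.
case/andP=> k_gt1 ks_gt1 hb hn; cbn [configs map].
have hw : \sum_(k <- k :: ks) N k * weight k <=
          2 * \sum_(k <- k :: ks) N k * (k * k.-1).
  rewrite big_distrr /=; apply: leq_sum => i _.
  by rewrite mulnCA leq_mul2l weight_le orbT.
rewrite ifF; last by apply/negbTE; rewrite -leqNgt; lia.
move: hb hn; rewrite !big_cons => hb hn.
apply/flatten_mapP; exists (N k).
  rewrite mem_iota add0n ltnS leq_divRL; last by case: (k) k_gt1 => [|[]].
  exact: leq_trans (leq_addr _ _) hb.
by apply: map_f; apply: IH => //; lia.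
Qed.

Definition total (s : seq nat) (f : nat -> nat) : nat :=
  sumn [seq p.2 * f p.1 | p <- zip block_sizes s].

Definition deg_sum_max (k r : nat) : nat :=
  let u m := (2 * (k * k.-1) + (2 * m + 1) * k + m * m.+1 * r -
              k * k - m * m.+1) %/ (2 * m) in
  minn (u 1) (minn (u 2) (u 3)).

Definition feasible (s : seq nat) : bool :=
  let r := sumn s in
  let S := total s id in
  let H := total s (deg_sum_max^~ r) in
  [&& 9 * S <= H + 240, 11 * S <= H + 360 &
      (nth 0 s 8 < 2) ==>
      (S <= 60) && all (fun p => (0 < p.2) ==>
                          (5 * p.1 + S <= 60 + deg_sum_max p.1 r))
                       (zip block_sizes s)].

Definition critical_configs : seq (seq nat) :=
  [:: [:: 0; 0; 0; 0; 0; 0; 3; 8; 0]; [:: 0; 0; 0; 0; 0; 0; 4; 6; 1];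
      [:: 0; 0; 0; 0; 0; 0; 1; 10; 2]; [:: 0; 0; 0; 0; 0; 0; 3; 7; 2]].

Lemma feasible_configs s :
  s \in configs block_sizes 264 481 -> feasible s -> s \in critical_configs.
Proof.
have : all (fun s => feasible s ==> (s \in critical_configs))
           (configs block_sizes 264 481) by vm_compute.
by move=> /allP h /h /implyP.
Qed.

Lemma cap_card (T : finType) (A D : {set T}) :
  #|A :&: D| = \sum_(o in A) (o \in D).
Proof.
rewrite -sum1_card big_mkcond /= [RHS]big_mkcond /=.
by apply: eq_bigr => o _; rewrite inE; case: (o \in A); case: (o \in D).
Qed.

Lemma card_rem (T : finType) (A : {set T}) x :
  x \in A -> #|[pred y in A | y != x]| = #|A|.-1.
Proof.
by move=> xA; rewrite (cardD1 x A) xA; apply: eq_card => y; rewrite !inE andbC.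
Qed.

Section Packing.

Variables (I C : finType) (P : {set I}) (B : {set C}) (b : C -> {set I}).

Definition pair_deg (o o' : I) : nat :=
  \sum_(c in B) ((o \in b c) && (o' \in b c)).
Definition point_deg (o : I) : nat := \sum_(c in B) (o \in b c).
Definition deg_sum (c : C) : nat := \sum_(o in b c) point_deg o.
Definition defect (c : C) : nat :=
  \sum_(o in b c) \sum_(o' in b c | o' != o) (2 - pair_deg o o').
Definition nblocks (k : nat) : nat := #|[set c in B | #|b c| == k]|.

Hypothesis cardP : #|P| = 12.
Hypothesis subP : forall c, c \in B -> b c \subset P.
Hypothesis block_gt3 : forall c, c \in B -> 3 < #|b c|.
Hypothesis pair_le2 :
  forall o o', o \in P -> o' \in P -> o' != o -> pair_deg o o' <= 2.

Lemma pair_degC o o' : pair_deg o o' = pair_deg o' o.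
Proof. by apply: eq_bigr => c _; rewrite andbC. Qed.

Lemma pair_deg_id o : pair_deg o o = point_deg o.
Proof. by apply: eq_bigr => c _; rewrite andbb. Qed.

Lemma sum_cap c : \sum_(c' in B) #|b c :&: b c'| = deg_sum c.
Proof.
rewrite /deg_sum /point_deg exchange_big /=.
by apply: eq_bigr => c' _; rewrite cap_card.
Qed.

Lemma sum_cap_sqr c :
  \sum_(c' in B) #|b c :&: b c'| * #|b c :&: b c'| =
  \sum_(o in b c) \sum_(o' in b c) pair_deg o o'.
Proof.
rewrite /pair_deg.
under [RHS]eq_bigr do rewrite exchange_big /=.
rewrite exchange_big /=; apply: eq_bigr => c' _.
rewrite cap_card big_distrl /=; apply: eq_bigr => o _.
rewrite big_distrr /=; apply: eq_bigr => o' _.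
by case: (o \in _); case: (o' \in _).
Qed.

Lemma sum_cap_pair y c :
  \sum_(c' in B | y \in b c') #|b c :&: b c'| = \sum_(z in b c) pair_deg y z.
Proof.
rewrite /pair_deg exchange_big /= [LHS]big_mkcondr /=.
apply: eq_bigr => c' _; rewrite cap_card; case: (y \in b c') => //=.
by rewrite big1.
Qed.

Lemma sum_point_deg : \sum_(o in P) point_deg o = \sum_(c in B) #|b c|.
Proof.
rewrite /point_deg exchange_big /=; apply: eq_bigr => c cB.
by rewrite -cap_card; congr #|pred_of_set _|; apply/setIidPr/subP.
Qed.

Lemma sum_deg_sum :
  \sum_(c in B) deg_sum c = \sum_(o in P) point_deg o * point_deg o.
Proof.
rewrite /deg_sum.
rewrite (eq_bigr (fun c => \sum_(o in P) (o \in b c) * point_deg o)).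
  rewrite exchange_big /=; apply: eq_bigr => o _.
  by rewrite -big_distrl.
move=> c cB; rewrite big_mkcond [RHS]big_mkcond /=; apply: eq_bigr => o _.
case oc: (o \in b c); last by rewrite mul0n if_same.
by rewrite mul1n (subsetP (subP cB)).
Qed.

Lemma sum_pair_deg o :
  \sum_(o' in P) pair_deg o o' = \sum_(c in B | o \in b c) #|b c|.
Proof.
rewrite /pair_deg exchange_big [RHS]big_mkcondr /=; apply: eq_bigr => c cB.
case: (o \in b c) => /=; last by rewrite big1.
by rewrite -cap_card; congr #|pred_of_set _|; apply/setIidPr/subP.
Qed.

Lemma sum_pair_degD1 o : o \in P ->
  point_deg o + \sum_(o' in P | o' != o) pair_deg o o' =
  \sum_(c in B | o \in b c) #|b c|.
Proof.
by move=> oP; rewrite -sum_pair_deg (bigD1 o oP) /= pair_deg_id.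
Qed.

Lemma card_others o : o \in P -> #|[pred o' in P | o' != o]| = 11.
Proof. by move=> oP; rewrite card_rem // cardP. Qed.

Lemma sum_defect c : c \in B ->
  \sum_(o in b c) \sum_(o' in b c) pair_deg o o' + defect c =
  deg_sum c + 2 * (#|b c| * #|b c|.-1).
Proof.
move=> cB; rewrite /defect /deg_sum -big_split /=.
have -> : 2 * (#|b c| * #|b c|.-1) = \sum_(o in b c) 2 * #|b c|.-1.
  by rewrite sum_nat_const; lia.
rewrite -big_split /=; apply: eq_bigr => o oc.
rewrite (bigD1 o oc) /= pair_deg_id -addnA; congr (_ + _).
rewrite -big_split /= (eq_bigr (fun _ => 2)).
  rewrite sum_nat_const mulnC; congr (_ * _).
  by rewrite [in RHS](cardD1 o) oc /=; apply: eq_card => x; rewrite !inE andbC.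
move=> o' /andP[oc' ne]; rewrite subnKC //.
by apply: pair_le2 => //; apply: (subsetP (subP cB)).
Qed.

Lemma block_identity m c : c \in B ->
  \sum_(c' in B | c' != c) gap m #|b c :&: b c'| + defect c +
    2 * m * deg_sum c + #|b c| * #|b c| + m * m.+1 =
  2 * (#|b c| * #|b c|.-1) + (2 * m + 1) * #|b c| + m * m.+1 * #|B|.
Proof.
move=> cB.
have E1 : \sum_(c' in B) gap m #|b c :&: b c'| + (2 * m + 1) * deg_sum c =
    \sum_(o in b c) \sum_(o' in b c) pair_deg o o' + m * m.+1 * #|B|.
  rewrite -sum_cap -sum_cap_sqr big_distrr -big_split /=.
  rewrite (eq_bigr _ (fun c' _ => gapE m _)) big_split /= sum_nat_const.
  by rewrite [#|B| * _]mulnC.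
have := sum_defect cB; have := gapE m #|b c|.
move: E1; rewrite (bigD1 c) //= setIid; lia.
Qed.

Lemma deg_sum_bound m c : c \in B ->
  2 * m * deg_sum c + #|b c| * #|b c| + m * m.+1 <=
  2 * (#|b c| * #|b c|.-1) + (2 * m + 1) * #|b c| + m * m.+1 * #|B|.
Proof. by move=> cB; rewrite -(block_identity m cB); lia. Qed.

Lemma pairs_total :
  \sum_(c in B) #|b c| * #|b c|.-1 +
    \sum_(o in P) \sum_(o' in P | o' != o) (2 - pair_deg o o') = 264.
Proof.
have -> : \sum_(c in B) #|b c| * #|b c|.-1 =
          \sum_(o in P) \sum_(o' in P | o' != o) pair_deg o o'.
  have : \sum_(o in P) (point_deg o +
            \sum_(o' in P | o' != o) pair_deg o o') =
         \sum_(o in P) \sum_(c in B | o \in b c) #|b c|.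
    by apply: eq_bigr => o /sum_pair_degD1.
  rewrite big_split /= sum_point_deg.
  rewrite (exchange_big_dep (mem B)) /=; last by move=> o c _ /andP[].
  have -> : \sum_(c in B) \sum_(o in P | (c \in B) && (o \in b c)) #|b c| =
            \sum_(c in B) (#|b c| + #|b c| * #|b c|.-1).
    apply: eq_bigr => c cB; rewrite sum_nat_const.
    have -> : #|[pred o in P | (c \in B) && (o \in b c)]| = #|b c|.
      apply: eq_card => o; rewrite !inE cB /=.
      by case oc: (o \in b c); rewrite ?andbF // (subsetP (subP cB)).
    by have := block_gt3 cB; case: #|b c| => // k _; rewrite mulnS.
  by rewrite big_split /= => /addnI ->.
rewrite -big_split /= (eq_bigr (fun _ => 22)); first by rewrite sum_nat_const cardP.
move=> o oP; rewrite -big_split /= (eq_bigr (fun _ => 2)).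
  by rewrite sum_nat_const (card_others oP).
by move=> o' /andP[oP' ne]; rewrite subnKC // pair_le2.
Qed.

Lemma block_le12 c : c \in B -> #|b c| <= 12.
Proof. by move=> cB; rewrite -cardP subset_leq_card // subP. Qed.

Lemma sum_by_size (f : nat -> nat) :
  \sum_(c in B) f #|b c| = \sum_(4 <= k < 13) nblocks k * f k.
Proof.
transitivity (\sum_(c in B) \sum_(4 <= k < 13 | k == #|b c|) f k).
  apply: eq_bigr => c cB; rewrite big_nat1_eq.
  by have := block_gt3 cB; have := block_le12 cB; case: ifP; lia.
under eq_bigr do rewrite big_mkcond /=.
rewrite exchange_big /=; apply: eq_bigr => k _.
rewrite -big_mkcondr /= sum_nat_const; congr (_ * _).
by apply: eq_card => c; rewrite !inE eq_sym.
Qed.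

Lemma point_deg_bound o : o \in P ->
  4 * point_deg o <= 22 + \sum_(c in B | #|b c| == 4) (o \in b c).
Proof.
move=> oP; have := sum_pair_degD1 oP.
have : \sum_(o' in P | o' != o) pair_deg o o' <= 22.
  rewrite -[22]/(11 * 2) -(card_others oP) -sum_nat_const.
  by apply: leq_sum => o' /andP[oP' ne]; apply: pair_le2.
have : 5 * point_deg o <= \sum_(c in B | o \in b c) #|b c| +
         \sum_(c in B | #|b c| == 4) (o \in b c).
  rewrite [X in _ <= X + _]big_mkcondr [X in _ <= _ + X]big_mkcondr /=.
  rewrite /point_deg -big_split big_distrr /=.
  by apply: leq_sum => c /block_gt3; case: (o \in b c); case: eqP; lia.
lia.
Qed.

Lemma total_nblocks f :
  total (map nblocks block_sizes) f = \sum_(c in B) f #|b c|.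
Proof.
rewrite sum_by_size unlock /= /total /=; lia.
Qed.

Lemma sumn_nblocks : sumn (map nblocks block_sizes) = #|B|.
Proof.
rewrite -sum1_card (sum_by_size (fun=> 1)) unlock /=; lia.
Qed.

Lemma deg_sum_le c : c \in B -> deg_sum c <= deg_sum_max #|b c| #|B|.
Proof.
move=> cB; rewrite /deg_sum_max !leq_min.
by apply/and3P; split; rewrite leq_divRL //;
  [have := deg_sum_bound 1 cB | have := deg_sum_bound 2 cB
  | have := deg_sum_bound 3 cB]; lia.
Qed.

Lemma four_block_count o :
  \sum_(c in B | #|b c| == 4) (o \in b c) <= nblocks 4.
Proof.
rewrite /nblocks -sum1_card; under [X in _ <= X]eq_bigl do rewrite inE.
by apply: leq_sum => c _; case: (_ \in _).
Qed.

Lemma point_deg_le5 o : nblocks 4 < 2 -> o \in P -> point_deg o <= 5.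
Proof.
by move=> h oP; have := point_deg_bound oP; have := four_block_count o; lia.
Qed.

Lemma critical_nblocks : 480 < \sum_(c in B) weight #|b c| ->
  map nblocks block_sizes \in critical_configs.
Proof.
move=> hW; apply: feasible_configs.
  apply: mem_configs => //.
    apply: leq_trans (_ : \sum_(c in B) #|b c| * #|b c|.-1 <= _).
      rewrite (sum_by_size (fun k => k * k.-1)) unlock /=; lia.
    by have := pairs_total; lia.
  apply: leq_trans hW _.
  rewrite (sum_by_size weight) unlock /=; lia.
set s := map _ _.
have Hle : \sum_(c in B) deg_sum c <= total s (deg_sum_max^~ (sumn s)).
  by rewrite sumn_nblocks total_nblocks; apply: leq_sum => c /deg_sum_le.
have S_E : total s id = \sum_(o in P) point_deg o.
  by rewrite total_nblocks sum_point_deg.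
move: Hle; rewrite /feasible S_E sum_deg_sum => Hle; apply/and3P; split.
- apply: leq_trans (leq_add Hle (leqnn _)).
  rewrite -[240]/(12 * 20) -[X in X * 20]cardP -sum_nat_const -big_split big_distrr /=.
  apply: leq_sum => o _; case: (point_deg o) => [|[|[|[|[|d]]]]] //; nia.
- apply: leq_trans (leq_add Hle (leqnn _)).
  rewrite -[360]/(12 * 30) -[X in X * 30]cardP -sum_nat_const -big_split big_distrr /=.
  apply: leq_sum => o _; case: (point_deg o) => [|[|[|[|[|[|d]]]]]] //; nia.
apply/implyP => n4; have le5 o (oP : o \in P) := point_deg_le5 n4 oP.
have S60 : \sum_(o in P) point_deg o <= 60.
  by rewrite -[60]/(12 * 5) -cardP -sum_nat_const; apply: leq_sum => o /le5.
rewrite S60 andTb; apply/allP => kn kn_s; apply/implyP => n_gt0.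
have [c cB <-] : exists2 c, c \in B & #|b c| = kn.1.
  have nE : kn.2 = nblocks kn.1.
    by move: kn_s; rewrite !inE; do ![case/orP] => /eqP ->.
  move: n_gt0; rewrite nE => /card_gt0P[c].
  by rewrite inE => /andP[cB /eqP]; exists c.
rewrite sumn_nblocks; apply: leq_trans (leq_add (leqnn 60) (deg_sum_le cB)).
have : \sum_(o in b c) (5 - point_deg o) <= \sum_(o in P) (5 - point_deg o).
  by rewrite [X in _ <= X](big_setID (b c)) /= (setIidPr (subP cB)) leq_addr.
have hc : \sum_(o in b c) (5 - point_deg o) + deg_sum c = 5 * #|b c|.
  rewrite -big_split /= mulnC -sum_nat_const; apply: eq_bigr => o oc.
  by rewrite subnK // le5 // (subsetP (subP cB)).
have hP : \sum_(o in P) (5 - point_deg o) + \sum_(o in P) point_deg o = 60.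
  rewrite -big_split /= -[60]/(12 * 5) -cardP -sum_nat_const.
  by apply: eq_bigr => o /le5 ?; rewrite subnK.
lia.
Qed.

Definition special_point (j : I) : Prop :=
  j \in P /\
  [/\ #|B| = 11, point_deg j = 3,
      forall c, c \in B -> #|b c| = (if j \in b c then 6 else 5),
      forall o, o \in P -> o != j -> point_deg o = 5 &
      forall o o', o \in P -> o' \in P -> o != j -> o' != j -> o' != o ->
        pair_deg o o' = 2].

Lemma low_point_in_six_block c o :
  nblocks 4 < 2 -> #|B| = 11 -> \sum_(c in B) #|b c| = 58 ->
  c \in B -> #|b c| = 6 -> o \in P -> point_deg o < 5 -> o \in b c.
Proof.
move=> n4 cardB S58 cB c6 oP low; apply/negPn/negP => o_c.
have le5 o' (h : o' \in P) := point_deg_le5 n4 h.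
have R28 : deg_sum c <= 28 by have := deg_sum_le cB; rewrite c6 cardB.
have hc : \sum_(o' in b c) (5 - point_deg o') + deg_sum c = 30.
  rewrite -big_split /= -[30]/(6 * 5) -c6 -sum_nat_const.
  by apply: eq_bigr => o' oc; rewrite subnK // le5 // (subsetP (subP cB)).
have hP : \sum_(o' in P) (5 - point_deg o') + \sum_(o' in P) point_deg o' = 60.
  rewrite -big_split /= -[60]/(12 * 5) -cardP -sum_nat_const.
  by apply: eq_bigr => o' /le5 ?; rewrite subnK.
move: hP; rewrite sum_point_deg S58 (big_setID (b c)) /= (setIidPr (subP cB)).
rewrite [\sum_(_ in P :\: _) _](big_setD1 o) /=; last by rewrite in_setD o_c.
lia.
Qed.

Lemma six_blocks_common o o' :
  (forall c, c \in B -> #|b c| = 6 -> (o \in b c) && (o' \in b c)) ->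
  nblocks 6 <= pair_deg o o'.
Proof.
move=> h; rewrite /nblocks -sum1_card; under eq_bigl do rewrite inE.
rewrite big_mkcondr /=; apply: leq_sum => c cB.
by case: eqP => // /(h c cB) ->.
Qed.

Lemma unique_low_point :
  nblocks 4 < 2 -> 2 < nblocks 6 -> #|B| = 11 ->
  \sum_(c in B) #|b c| = 58 ->
  exists j, [/\ j \in P, point_deg j = 3, nblocks 6 <= 3,
    forall c, c \in B -> #|b c| = 6 -> j \in b c &
    forall o, o \in P -> o != j -> point_deg o = 5].
Proof.
move=> n4 n6 cardB S58.
have le5 o (h : o \in P) := point_deg_le5 n4 h.
have low c o := @low_point_in_six_block c o n4 cardB S58.
have S58' := etrans sum_point_deg S58.
have [j jP jlow] : exists2 j, j \in P & point_deg j < 5.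
  apply/exists_inP; rewrite -[X in is_true X]negbK negb_exists_in.
  apply/negP => /forall_inP h.
  have : \sum_(o in P) 5 <= \sum_(o in P) point_deg o.
    by apply: leq_sum => o /h; rewrite -leqNgt.
  by rewrite sum_nat_const cardP S58'.
have other o : o \in P -> o != j -> point_deg o = 5.
  move=> oP oj; apply/eqP; rewrite eqn_leq le5 // leqNgt; apply/negP => olow.
  have := pair_le2 jP oP oj; apply/negP; rewrite -ltnNge.
  apply: (leq_trans n6); apply: six_blocks_common => c cB c6.
  by rewrite !low.
have j3 : point_deg j = 3.
  move: S58'; rewrite (big_setD1 j jP) /= (eq_bigr (fun=> 5)).
    rewrite sum_nat_const; have := cardsD1 j P; rewrite jP cardP; lia.
  by move=> o; rewrite !inE => /andP[oj oP]; apply: other.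
exists j; split=> //; last by move=> c cB c6; apply: low.
suff : nblocks 6 <= pair_deg j j by rewrite pair_deg_id j3.
by apply: six_blocks_common => c cB c6; rewrite low.
Qed.

Lemma special_of_config :
  map nblocks block_sizes = [:: 0; 0; 0; 0; 0; 0; 3; 8; 0] ->
  exists j, special_point j.
Proof.
move=> E; have := total_nblocks id; have := sumn_nblocks.
have := total_nblocks (fun k => k * k.-1); rewrite E.
rewrite [LHS]/= => /esym totE /esym cardB /esym S58.
move: E => [n12 n11 n10 n9 n8 n7 n6 n5 n4].
have [||j [jP j3 _ j6 other]] := unique_low_point _ _ cardB S58.
- by rewrite n4.
- by rewrite n6.
have size56 c : c \in B -> (#|b c| == 5) || (#|b c| == 6).
  move=> cB; have := block_gt3 cB; have := block_le12 cB.
  have nz : 0 < nblocks #|b c| by apply/card_gt0P; exists c; rewrite inE cB eqxx.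
  move: nz; case: #|b c| => [|[|[|[|[|[|[|[|[|[|[|[|[|k]]]]]]]]]]]]] //;
  by rewrite ?n12 ?n11 ?n10 ?n9 ?n8 ?n7 ?n4.
have jblocks c : c \in B -> (j \in b c) = (#|b c| == 6).
  move=> cB; apply/idP/eqP; last exact: j6.
  move=> jc; apply/eqP; apply: contraT => c6.
  have : nblocks 6 + 1 <= point_deg j.
    rewrite /nblocks -sum1_card; under eq_bigl do rewrite inE.
    rewrite big_mkcondr /= /point_deg (bigD1 c) // [X in _ <= X](bigD1 c) //=.
    rewrite jc (negPf c6) add0n addnC leq_add2l; apply: leq_sum => c' /andP[c'B _].
    by case: eqP => // /(j6 c' c'B) ->.
  by rewrite j3 n6.
exists j; split=> //; split=> //.
  by move=> c cB; rewrite jblocks //; have := size56 c cB; case: eqP; case: eqP => //; lia.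
have jdef : \sum_(o in P | o != j) (2 - pair_deg o j) = 7.
  have : \sum_(o in P | o != j) (2 - pair_deg o j) +
         \sum_(o in P | o != j) pair_deg j o = 22.
    rewrite -big_split /= (eq_bigr (fun=> 2)) ?sum_nat_const ?card_others //.
    by move=> o /andP[oP oj]; rewrite pair_degC subnK // pair_degC pair_le2 // eq_sym.
  have := sum_pair_degD1 jP; rewrite j3.
  have -> : \sum_(c in B | j \in b c) #|b c| = 18; last lia.
  rewrite (eq_bigr (fun=> 6)); last by move=> c /andP[cB]; rewrite jblocks // => /eqP.
  transitivity (point_deg j * 6); last by rewrite j3.
  rewrite big_mkcondr /= big_distrl /=.
  by apply: eq_bigr => c _; case: (j \in b c).
have := pairs_total; rewrite totE -[total _ _]/250 (bigD1 j jP) /=.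
have -> : \sum_(o' in P | o' != j) (2 - pair_deg j o') = 7.
  by rewrite -jdef; apply: eq_bigr => o _; rewrite pair_degC.
have -> : \sum_(o in P | o != j) \sum_(o' in P | o' != o) (2 - pair_deg o o') =
  7 + \sum_(o in P | o != j) \sum_(o' in P | (o' != o) && (o' != j))
        (2 - pair_deg o o').
  rewrite -jdef -big_split /=; apply: eq_bigr => o /andP[oP oj].
  rewrite (bigD1 j) ?jP 1?eq_sym //=; congr (_ + _).
  by apply: eq_bigl => o'; rewrite andbA.
move=> tot0.
have : \sum_(o in P | o != j) \sum_(o' in P | (o' != o) && (o' != j))
        (2 - pair_deg o o') = 0 by lia.
move=> /eqP; rewrite sum_nat_eq0 => /forallP h o o' oP o'P oj o'j o'o.
have := h o; rewrite oP oj sum_nat_eq0 => /forallP /(_ o').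
rewrite o'P o'j o'o /=; have := pair_le2 oP o'P o'o; lia.
Qed.

Lemma point_deg_le_in_four_block c o :
  nblocks 4 = 2 -> c \in B -> #|b c| = 4 -> o \in P ->
  point_deg o <= 5 + (o \in b c).
Proof.
move=> n4 cB c4 oP; have := point_deg_bound oP.
have : \sum_(c in B | #|b c| == 4) (o \in b c) <= 1 + (o \in b c).
  rewrite (bigD1 c) /= ?cB ?c4 // addnC leq_add2r.
  apply: leq_trans (_ : \sum_(i in B | (#|b i| == 4) && (i != c)) 1 <= _).
    rewrite (eq_bigl (fun i => (i \in B) && ((#|b i| == 4) && (i != c)))).
      by apply: leq_sum => i _; case: (o \in b i).
    by move=> i; rewrite andbA.
  rewrite sum1_card; have := cardsD1 c [set c in B | #|b c| == 4].
  rewrite inE cB c4 eqxx -/(nblocks 4) n4 => -[E].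
  rewrite [X in _ <= X]E add0n.
  by apply/subset_leq_card/subsetP => i; rewrite !inE => /and3P[-> -> ->].
by case: (o \in b c); lia.
Qed.

Lemma ex_four_block : nblocks 4 = 2 -> exists2 c, c \in B & #|b c| = 4.
Proof.
move=> n4; have : 0 < nblocks 4 by rewrite n4.
by move=> /card_gt0P[c]; rewrite inE => /andP[cB /eqP]; exists c.
Qed.

Lemma not_config_1_10_2 :
  map nblocks block_sizes <> [:: 0; 0; 0; 0; 0; 0; 1; 10; 2].
Proof.
move=> E; have := total_nblocks id; have := sumn_nblocks; rewrite E.
move=> /esym cardB /esym S64.
move: E => [_ _ _ _ _ _ _ _ n4].
have [c cB c4] := ex_four_block n4.
have h o (oP : o \in P) := point_deg_le_in_four_block n4 cB c4 oP.
have R22 : deg_sum c <= 22 by have := deg_sum_le cB; rewrite c4 cardB.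
have := etrans sum_point_deg S64; rewrite -[total _ _]/64.
rewrite (big_setID (b c)) /= (setIidPr (subP cB)) => tot.
have : \sum_(o in P :\: b c) point_deg o <= 8 * 5.
  have <- : #|P :\: b c| = 8.
    by rewrite cardsD (setIidPr (subP cB)) cardP c4.
  rewrite -sum_nat_const; apply: leq_sum => o; rewrite inE => /andP[oc oP].
  by have := h o oP; rewrite (negPf oc) addn0.
by move: R22 tot; rewrite /deg_sum; lia.
Qed.

Section Config372.

Hypothesis cfg : map nblocks block_sizes = [:: 0; 0; 0; 0; 0; 0; 3; 7; 2].

Let n4 : nblocks 4 = 2. Proof. by case: cfg. Qed.
Let n5 : nblocks 5 = 7. Proof. by case: cfg. Qed.
Let cardB : #|B| = 12. Proof. by rewrite -sumn_nblocks cfg. Qed.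
Let sum_deg : \sum_(o in P) point_deg o = 61.
Proof. by rewrite sum_point_deg -(total_nblocks id) cfg. Qed.
Let total_defect :
  \sum_(o in P) \sum_(o' in P | o' != o) (2 - pair_deg o o') = 10.
Proof.
have := pairs_total; rewrite -(total_nblocks (fun k => k * k.-1)) cfg.
by rewrite -[total _ _]/254; lia.
Qed.

Let size456 c : c \in B -> [|| #|b c| == 4, #|b c| == 5 | #|b c| == 6].
Proof.
move=> cB; have := block_gt3 cB; have := block_le12 cB.
have nz : 0 < nblocks #|b c| by apply/card_gt0P; exists c; rewrite inE cB eqxx.
move: cfg nz => [n12 n11 n10 n9 n8 n7 _ _ _].
case: #|b c| => [|[|[|[|[|[|[|[|[|[|[|[|[|k]]]]]]]]]]]]] //;
by rewrite ?n12 ?n11 ?n10 ?n9 ?n8 ?n7.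
Qed.

(* A point of degree less than 5 lies in both 4-blocks, by the bound on their
   degree sums; its pairs then have more than the available total defect. *)
Let point_deg_ge5 u : u \in P -> 5 <= point_deg u.
Proof.
move=> uP; rewrite leqNgt; apply/negP => ulow.
have uK c : c \in B -> #|b c| = 4 -> u \in b c.
  move=> cB c4; apply/negPn/negP => uc.
  have h o (oP : o \in P) := point_deg_le_in_four_block n4 cB c4 oP.
  have R21 : deg_sum c <= 21 by have := deg_sum_le cB; rewrite c4 cardB.
  have := sum_deg; rewrite (big_setID (b c)) /= (setIidPr (subP cB)).
  have uD : u \in P :\: b c by rewrite inE uc.
  rewrite [\sum_(_ in P :\: _) _](big_setD1 u uD) /=.
  have : \sum_(o in (P :\: b c) :\ u) point_deg o <= 7 * 5.
    have <- : #|(P :\: b c) :\ u| = 7.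
      have := cardsD1 u (P :\: b c); rewrite uD cardsD (setIidPr (subP cB)).
      by rewrite cardP c4 add1n => -[].
    rewrite -sum_nat_const; apply: leq_sum => o; rewrite !inE => /and3P[_ oc oP].
    by have := h o oP; rewrite (negPf oc) addn0.
  by move: R21; rewrite /deg_sum; lia.
have usum : \sum_(c in B | u \in b c) #|b c| + 4 <= 6 * point_deg u.
  have four : nblocks 4 <= \sum_(c in B) ((u \in b c) && (#|b c| == 4)).
    rewrite /nblocks -sum1_card; under eq_bigl do rewrite inE.
    rewrite big_mkcondr /=; apply: leq_sum => c cB.
    by case: eqP => // /(uK c cB) ->.
  apply: leq_trans (_ : \sum_(c in B | u \in b c) #|b c| +
           2 * \sum_(c in B) ((u \in b c) && (#|b c| == 4)) <= _).
    by rewrite leq_add2l; move: four; rewrite n4; lia.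
  rewrite big_mkcondr /point_deg !big_distrr /= -big_split /=.
  by apply: leq_sum => c /size456 /or3P[] /eqP ->; case: (u \in b c).
have udef : 6 <= \sum_(o in P | o != u) (2 - pair_deg u o).
  have : \sum_(o in P | o != u) (2 - pair_deg u o) +
         \sum_(o in P | o != u) pair_deg u o = 22.
    rewrite -big_split /= (eq_bigr (fun=> 2)) ?sum_nat_const ?card_others //.
    by move=> o /andP[oP ou]; rewrite subnK // pair_le2.
  by have := sum_pair_degD1 uP; lia.
have := total_defect; rewrite (bigD1 u) //=.
have : \sum_(o in P | o != u) (2 - pair_deg u o) <=
       \sum_(o in P | o != u) \sum_(o' in P | o' != o) (2 - pair_deg o o').
  apply: leq_sum => o /andP[oP ou]; rewrite (bigD1 u) ?uP 1?eq_sym //=.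
  by rewrite [pair_deg o u]pair_degC leq_addr.
lia.
Qed.

Let ex_deg6 : exists2 p, p \in P &
  point_deg p = 6 /\ forall o, o \in P -> o != p -> point_deg o = 5.
Proof.
have [p pP p5] : exists2 p, p \in P & 5 < point_deg p.
  apply/exists_inP; rewrite -[X in is_true X]negbK negb_exists_in.
  apply/negP => /forall_inP h.
  have : \sum_(o in P) point_deg o <= \sum_(o in P) 5.
    by apply: leq_sum => o /h; rewrite -leqNgt.
  by rewrite sum_nat_const cardP sum_deg.
have tot : \sum_(o in P) (point_deg o - 5) = 1.
  have : \sum_(o in P) (point_deg o - 5) + \sum_(o in P) 5 = 61.
    by rewrite -big_split -sum_deg; apply: eq_bigr => o /point_deg_ge5 /subnK.
  by rewrite sum_nat_const cardP; lia.
move: tot; rewrite (bigD1 p) //= => tot.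
exists p => //; split; first lia.
move=> o oP op; apply/eqP; rewrite eqn_leq point_deg_ge5 // andbT.
by move: tot; rewrite (bigD1 o) ?oP //=; lia.
Qed.

Lemma not_config_3_7_2 : False.
Proof.
have [p pP [p6 other]] := ex_deg6.
have pK c : c \in B -> #|b c| = 4 -> p \in b c.
  move=> cB c4; have := point_deg_le_in_four_block n4 cB c4 pP.
  by rewrite p6; case: (p \in b c).
have four_p : \sum_(c in B) ((p \in b c) && (#|b c| == 4)) = 2.
  transitivity (nblocks 4); last exact: n4.
  rewrite /nblocks -sum1_card [RHS]big_mkcond /= [LHS]big_mkcond /=.
  apply: eq_bigr => c _; rewrite inE; case cB: (c \in B) => //=.
  by case: eqP => [c4|_]; rewrite ?andbF // (pK c cB c4).
have [psize pdeg] : (forall c, c \in B -> p \in b c -> #|b c| != 6) /\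
    (forall o, o \in P -> o != p -> pair_deg p o = 2).
  have le22 : \sum_(o in P | o != p) pair_deg p o +
              \sum_(o in P | o != p) (2 - pair_deg p o) = 22.
    rewrite -big_split /= (eq_bigr (fun=> 2)) ?sum_nat_const ?card_others //.
    by move=> o /andP[oP ou]; rewrite subnKC // pair_le2.
  have := sum_pair_degD1 pP; rewrite p6 => sumE.
  have : \sum_(c in B | p \in b c) #|b c| +
         \sum_(c in B) ((p \in b c) && (#|b c| == 4)) =
         5 * point_deg p + \sum_(c in B) ((p \in b c) && (#|b c| == 6)).
    rewrite big_mkcondr /point_deg big_distrr /= -!big_split /=.
    by apply: eq_bigr => c /size456 /or3P[] /eqP ->; case: (p \in b c).
  rewrite four_p p6 => szE; split.
    move=> c cB pc; apply/negP => c6.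
    have : \sum_(c in B) ((p \in b c) && (#|b c| == 6)) = 0 by lia.
    by move/eqP; rewrite sum_nat_eq0 => /forallP /(_ c); rewrite cB pc c6.
  move=> o oP op.
  have : \sum_(o in P | o != p) (2 - pair_deg p o) = 0 by lia.
  move/eqP; rewrite sum_nat_eq0 => /forallP /(_ o); rewrite oP op /=.
  by have := pair_le2 pP oP op; lia.
have degE c : c \in B -> deg_sum c = 5 * #|b c| + (p \in b c).
  move=> cB; rewrite /deg_sum (eq_bigr (fun o => 5 + (o == p))).
    rewrite big_split sum_nat_const mulnC; congr (_ + _).
    case pc: (p \in b c).
      by rewrite (bigD1 p) //= eqxx big1 // => o /andP[_ /negPf->].
    by rewrite big1 // => o oc; case: eqP => // op; rewrite -op oc in pc.
  move=> o /(subsetP (subP cB)) oP.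
  by case: (eqVneq o p) => [->|/(other o oP) ->]; rewrite ?p6 ?addn0.
have gaps1 c : c \in B -> p \in b c -> #|b c| = 5 ->
    \sum_(c' in B | c' != c) gap 1 #|b c :&: b c'| = 0.
  move=> cB pc c5; have := block_identity 1 cB.
  by rewrite degE // pc c5 cardB; lia.
have def_le c : c \in B -> defect c <= 2 * ((#|b c| == 5) && (p \notin b c)).
  move=> cB; have := block_identity 1 cB; have := block_identity 2 cB.
  rewrite degE // cardB; case/or3P: (size456 cB) => /eqP ck; rewrite ck /=.
  - by rewrite pK //; lia.
  - by case: (p \in b c); lia.
  - have /negPf-> : p \notin b c by apply/negP => /(psize c cB); rewrite ck.
    by lia.
have sum_def : \sum_(c in B) defect c <= 6.
  apply: leq_trans (_ : \sum_(c in B)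
    2 * ((#|b c| == 5) && (p \notin b c)) <= _); first exact: leq_sum.
  rewrite -big_distrr /= -[6]/(2 * 3) leq_mul2l /=.
  have : \sum_(c in B) ((#|b c| == 5) && (p \notin b c)) + point_deg p =
         nblocks 5 + \sum_(c in B) ((p \in b c) && (#|b c| == 4)).
    rewrite /nblocks -sum1_card; under [in RHS]eq_bigl do rewrite inE.
    rewrite big_mkcondr /point_deg -!big_split /=; apply: eq_bigr => c cB.
    have := psize c cB; case/or3P: (size456 cB) => /eqP ->;
    by case: (p \in b c) => // /(_ erefl).
  by rewrite p6 n5 four_p; lia.
(* A block [F] through [p] of size 5 meets one other block in 1 point and the
   rest in 2, so the blocks through a point [y] outside it meet it in at least
   [2 * 5 - 1] points, although at most 2 of them contain any given point of [F]
   and none contains [x]. *)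
have no_zero_in F x y : F \in B -> p \in b F -> #|b F| = 5 -> x \in b F ->
    y \in P -> y != p -> pair_deg y x = 0 -> False.
  move=> FB pF F5 xF yP yp yx0.
  have yF : y \notin b F.
    apply/negP => yF; move: yx0; rewrite /pair_deg (bigD1 F) //= yF xF; lia.
  have cap2 c : c \in B -> c != F -> 0 < #|b F :&: b c| <= 2.
    move=> cB cF; have := gaps1 F FB pF F5 => /eqP; rewrite sum_nat_eq0.
    move=> /forallP /(_ c); rewrite cB cF /= /gap.
    by case: #|_| => [|[|[|n]]].
  have sumF : \sum_(c in B | c != F) #|b F :&: b c| = 21.
    have := sum_cap F; rewrite degE // pF F5 (bigD1 F) //= setIid F5; lia.
  have short : \sum_(c in B | c != F) (2 - #|b F :&: b c|) = 1.
    have : \sum_(c in B | c != F) (2 - #|b F :&: b c|) +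
           \sum_(c in B | c != F) #|b F :&: b c| = 11 * 2.
      have <- : #|[pred c in B | c != F]| = 11.
        have := cardB; rewrite (cardD1 F) FB => -[<-].
        by apply: eq_card => c; rewrite !inE andbC.
      rewrite -big_split -sum_nat_const /=; apply: eq_bigr => c /andP[cB cF].
      by rewrite subnK //; case/andP: (cap2 c cB cF).
    by rewrite sumF; lia.
  have : 2 * point_deg y <= \sum_(c in B | y \in b c) #|b F :&: b c| +
                            \sum_(c in B | c != F) (2 - #|b F :&: b c|).
    rewrite /point_deg big_distrr /= [X in _ <= X + _]big_mkcondr /=.
    rewrite (bigD1 F) // [X in _ <= X + _](bigD1 F) //= (negPf yF) !add0n.
    rewrite -big_split /=; apply: leq_sum => c /andP[cB cF].
    by have /andP[_ ?] := cap2 c cB cF; case: (y \in b c); lia.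
  rewrite short sum_cap_pair other // (bigD1 x) //= yx0.
  have : \sum_(z in b F | z != x) pair_deg y z <= 4 * 2.
    have <- : #|[pred z in b F | z != x]| = 4.
      move: F5; rewrite (cardD1 x) xF => -[<-].
      by apply: eq_card => c; rewrite !inE andbC.
    rewrite -sum_nat_const; apply: leq_sum => z /andP[zF zx].
    apply: pair_le2 => //; first exact: (subsetP (subP FB)).
    by apply: contraNneq yF => <-.
  lia.
have through x : x \in P -> x != p ->
    (exists F, [/\ F \in B, p \in b F, #|b F| = 5 & x \in b F]) \/
    (forall c, c \in B -> #|b c| = 4 -> x \in b c).
  move=> xP xp.
  have [/exists_inP[F FB /and3P[pF /eqP F5 xF]]|] :=
    boolP [exists F in B, [&& p \in b F, #|b F| == 5 & x \in b F]].
    by left; exists F.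
  rewrite negb_exists_in => /forall_inP h; right => c cB c4.
  apply/negPn/negP => xc; have := pdeg x xP xp; rewrite /pair_deg => px.
  have : \sum_(c in B) ((p \in b c) && (x \in b c)) <
         \sum_(c in B) ((p \in b c) && (#|b c| == 4)).
    rewrite (bigD1 c) //= [X in _ < X](bigD1 c) //= (negPf xc) c4 (pK c) //.
    rewrite addnC ltnS addn0; apply: leq_sum => i /andP[iB _].
    have := h i iB; have := psize i iB; case/or3P: (size456 iB) => /eqP ->;
    by case: (p \in b i) => //=; case: (x \in b i) => // /(_ erefl).
  by rewrite px four_p.
have pair_gt0 x y : x \in P -> y \in P -> y != x -> 0 < pair_deg x y.
  move=> xP yP yx.
  have [xp|xp] := eqVneq x p; first by rewrite xp pdeg // -xp.
  have [yp|yp] := eqVneq y p; first by rewrite yp pair_degC pdeg // -yp eq_sym.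
  rewrite lt0n; apply/eqP => xy0.
  case: (through x xP xp) => [[F [FB pF F5 xF]]|x4].
    by apply: (no_zero_in F x y); rewrite // pair_degC.
  case: (through y yP yp) => [[F [FB pF F5 yF]]|y4].
    exact: (no_zero_in F y x).
  have [c cB c4] := ex_four_block n4.
  by move: xy0; rewrite /pair_deg (bigD1 c) //= x4 // y4.
have def_total : \sum_(c in B) defect c =
    \sum_(o in P) \sum_(o' in P | o' != o) pair_deg o o' * (2 - pair_deg o o').
  transitivity (\sum_(c in B) \sum_(o in P) \sum_(o' in P | o' != o)
      ((o \in b c) && (o' \in b c)) * (2 - pair_deg o o')).
    apply: eq_bigr => c cB; rewrite /defect big_mkcond [RHS]big_mkcond /=.
    apply: eq_bigr => o _; case oc: (o \in b c) => /=; last first.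
      by case: ifP => // _; rewrite big1.
    rewrite (subsetP (subP cB)) // big_mkcond [RHS]big_mkcond /=.
    apply: eq_bigr => o' _; case oc': (o' \in b c) => /=.
      by rewrite (subsetP (subP cB)) // mul1n.
    by rewrite mul0n if_same.
  rewrite exchange_big; apply: eq_bigr => o _ /=.
  by rewrite exchange_big; apply: eq_bigr => o' _; rewrite -big_distrl.
have : \sum_(o in P) \sum_(o' in P | o' != o) (2 - pair_deg o o') <=
       \sum_(c in B) defect c.
  rewrite def_total; apply: leq_sum => o oP; apply: leq_sum => o' /andP[o'P o'o].
  by rewrite -[X in X <= _]mul1n leq_mul2r pair_gt0 ?orbT.
by rewrite total_defect; lia.
Qed.

End Config372.

Lemma not_config_4_6_1 :
  map nblocks block_sizes <> [:: 0; 0; 0; 0; 0; 0; 4; 6; 1].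
Proof.
move=> E; have := total_nblocks id; have := sumn_nblocks; rewrite E.
move=> /esym cardB /esym S58; move: E => [_ _ _ _ _ _ n6 _ n4].
have [||j [_ _]] := unique_low_point _ _ cardB S58; first by rewrite n4.
  by rewrite n6.
by rewrite n6.
Qed.

Theorem packing_weight :
  \sum_(c in B) weight #|b c| <= 480 \/ exists j, special_point j.
Proof.
have [|W] := leqP (\sum_(c in B) weight #|b c|) 480; first by left.
right; have := critical_nblocks W; rewrite !inE.
case/or4P=> /eqP E; first exact: special_of_config.
- by case: (not_config_4_6_1 E).
- by case: (not_config_1_10_2 E).
- by case: (not_config_3_7_2 E).
Qed.

End Packing.

(** * Special rows *)

Section Columns.

Variables (R C : finType) (col : C -> {set R}).

Hypothesis cardR : #|R| = 13.
Hypothesis cardC : #|C| = 22.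
Hypothesis no_three : forall i j k : R, i != j -> i != k -> j != k ->
  #|[set c | [&& i \in col c, j \in col c & k \in col c]]| <= 2.
Hypothesis ones : 138 <= \sum_c #|col c|.

(* Columns of size at most 4 have weight 0 and are ignored. *)
Definition through (i : R) : {set C} :=
  [set c | (4 < #|col c|) && (i \in col c)].
Definition row_weight (i : R) : nat :=
  \sum_(c in through i) weight #|col c|.-1.

Lemma no_three_through i j k : i != j -> i != k -> j != k ->
  #|through i :&: through j :&: through k| <= 2.
Proof.
move=> ij ik jk; apply: leq_trans (no_three ij ik jk).
apply/subset_leq_card/subsetP => c; rewrite !inE.
by case/andP=> /andP[/andP[_ ->] /andP[_ ->]] /andP[_ ->].
Qed.

Lemma no_three_cols a b c : a != b -> a != c -> b != c ->
  #|col a :&: col b :&: col c| <= 2.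
Proof.
move=> ab ac bc; rewrite leqNgt; apply/card_gt2P => -[x [y [z [[]]]]].
rewrite !inE => /andP[/andP[xa xb] xc] /andP[/andP[ya yb] yc].
move=> /andP[/andP[za zb] zc] [xy yz zx].
have := no_three xy; move=> /(_ z); rewrite eq_sym zx => /(_ isT yz).
apply/negP; rewrite -ltnNge.
have c3 : #|[set a; b; c]| = 3.
  by rewrite -setUA cardsU1 cards2 !inE negb_or ab ac bc.
rewrite -[X in X <= _]c3; apply/subset_leq_card/subsetP => d; rewrite !inE.
by case/orP=> [/orP[]|] /eqP->; apply/and3P.
Qed.

Section Row.

Variable i : R.
Let B := through i.
Let b c := col c :\ i.

Lemma pair_deg_through o o' : o != i -> o' != i ->
  pair_deg B b o o' = #|through i :&: through o :&: through o'|.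
Proof.
move=> oi o'i; rewrite /pair_deg -sum1_card big_mkcond [RHS]big_mkcond /=.
apply: eq_bigr => c _; rewrite !inE oi o'i /=.
by case: (4 < _); case: (i \in _); case: (o \in _); case: (o' \in _).
Qed.

Lemma point_deg_through o : o != i ->
  point_deg B b o = #|through i :&: through o|.
Proof.
by move=> oi; rewrite -pair_deg_id pair_deg_through // -setIA setIid.
Qed.

Lemma card_block c : c \in B -> #|col c| = #|b c|.+1.
Proof. by rewrite inE => /andP[_ ic]; rewrite /b (cardsD1 i) ic. Qed.

(* The columns through [i] are the blocks of a biplane on the 11 rows other than
   [i] and [j], three of them enlarged by [j]. *)
Definition special (j : R) : Prop :=
  [/\ i != j, #|through i| = 11, #|through i :&: through j| = 3 &
      forall c, c \in through i -> #|col c| = if j \in col c then 7 else 6] /\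
  (forall o, o != i -> o != j -> #|through i :&: through o| = 5) /\
  (forall o o', o != i -> o' != i -> o != j -> o' != j -> o != o' ->
     #|through i :&: through o :&: through o'| = 2).

Lemma row_weight_special : 480 < row_weight i -> exists j, special j.
Proof.
have WE : row_weight i = \sum_(c in B) weight #|b c|.
  by apply: eq_bigr => c cB; rewrite (card_block cB).
have [] := @packing_weight _ _ [set~ i] B b.
- by rewrite cardsC1 cardR.
- by move=> c _; apply/subsetP => o; rewrite !inE => /andP[].
- by move=> c cB; move: (cB); rewrite inE (card_block cB) => /andP[].
- move=> o o'; rewrite !inE => oi o'i o'o; rewrite pair_deg_through //.
  by apply: no_three_through; rewrite // eq_sym.
- by rewrite leqNgt -WE => /negP.
case=> j [jP [cardB j3 szj deg5 pair2]] _; exists j.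
rewrite !inE in jP; split; last split.
- split; rewrite -?point_deg_through // 1?eq_sym // => c cB.
  by rewrite (card_block cB) szj // !inE jP; case: (j \in col c).
- by move=> o oi oj; rewrite -point_deg_through // deg5 // !inE.
- move=> o o' oi o'i oj o'j oo'; rewrite -pair_deg_through // pair2 ?inE //.
  by rewrite eq_sym.
Qed.

End Row.

Lemma card_row_cap (A : {set R}) (B : {set C}) :
  (forall c, c \in B -> 4 < #|col c|) ->
  \sum_(c in B) #|A :&: col c| = \sum_(o in A) #|B :&: through o|.
Proof.
move=> hB; rewrite (eq_bigr (fun c => \sum_(o in A) (o \in col c))).
  rewrite exchange_big; apply: eq_bigr => o _ /=.
  rewrite -sum1_card [RHS]big_mkcond [LHS]big_mkcond.
  apply: eq_bigr => c _; rewrite !inE; case cB: (c \in B) => //=.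
  by rewrite hB //=; case: (o \in _).
by move=> c _; rewrite cap_card.
Qed.

Lemma special_cap i j a b : special i j ->
  a \in through i :&: through j -> b \in through i :&: through j -> a != b ->
  #|col a :&: col b| = 4.
Proof.
move=> [[ij ci cij sz] [deg5 pair2]] aij bij ab.
pose A := col a :\ i :\ j.
have ai : a \in through i by case/setIP: aij.
have [ia ja] : i \in col a /\ j \in col a.
  by move: aij; rewrite !inE => /andP[/andP[_ ->] /andP[_ ->]].
have A5 : #|A| = 5.
  have := sz a ai; rewrite ja (cardsD1 i) ia (cardsD1 j) !inE eq_sym ij ja.
  by rewrite !add1n => -[].
have inA o : o \in A -> o != i /\ o != j.
  by rewrite !inE => /and3P[-> ->].
have S1 : \sum_(c in through i) #|A :&: col c| = 25.
  rewrite card_row_cap; last by move=> c; rewrite inE => /andP[].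
  rewrite (eq_bigr (fun=> 5)) ?sum_nat_const ?A5 // => o /inA[oi oj].
  exact: deg5.
have S2 : \sum_(c in through i) #|A :&: col c| * #|A :&: col c| = 65.
  rewrite (eq_bigr (fun c => \sum_(o in A) (o \in col c) * #|A :&: col c|)); last first.
    by move=> c _; rewrite -big_distrl /= -cap_card.
  rewrite exchange_big (eq_bigr (fun=> 13)) ?sum_nat_const ?A5 // => o oA /=.
  have [oi oj] := inA o oA.
  transitivity (\sum_(c in through i :&: through o) #|A :&: col c|).
    rewrite big_mkcond [RHS]big_mkcond; apply: eq_bigr => c _; rewrite !inE.
    by case: (4 < _); case: (i \in _); case: (o \in _); rewrite /= ?mul1n.
  rewrite card_row_cap; last by move=> c; rewrite !inE => /andP[/andP[]].
  rewrite (bigD1 o) //= -setIA setIid deg5 // -[13]/(5 + 4 * 2); congr (_ + _).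
  rewrite (eq_bigr (fun=> 2)).
    by rewrite sum_nat_const card_rem // A5.
  by move=> o' /andP[/inA[o'i o'j] o'o]; apply: pair2; rewrite // eq_sym.
have bi : b \in through i by case/setIP: bij.
have AA : A :&: col a = A.
  by apply/setIidPl/subsetP => o; rewrite !inE => /and3P[].
have gap0 : \sum_(c in through i | c != a) gap 2 #|A :&: col c| = 0.
  have : \sum_(c in through i) gap 2 #|A :&: col c| +
      5 * \sum_(c in through i) #|A :&: col c| =
      \sum_(c in through i) #|A :&: col c| * #|A :&: col c| + 6 * 11.
    rewrite big_distrr -big_split /= (eq_bigr _ (fun c _ => gapE 2 _)).
    by rewrite big_split /= sum_nat_const ci [11 * _]mulnC.
  rewrite S1 S2 (bigD1 a) //= AA A5 -[gap 2 5]/6 -[65 + _]/(6 + 5 * 25) -addnA.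
  by move/addnI/(canRL (addnK _)).
have ge2 c : c \in through i -> c != a -> 2 <= #|A :&: col c|.
  move=> cB ca; move/eqP: gap0; rewrite sum_nat_eq0 => /forallP /(_ c).
  by rewrite cB ca /= /gap; case: #|_| => [|[|[|n]]].
have ab2 : #|A :&: col b| = 2.
  have := S1; rewrite (bigD1 a) //= AA A5 (bigD1 b) /=; last by rewrite bi eq_sym.
  have : 9 * 2 <= \sum_(c | (c \in through i) && (c != a) && (c != b))
                    #|A :&: col c|.
    have c9 : #|[pred c | (c \in through i) && (c != a) && (c != b)]| = 9.
      have := cardsD1 a (through i); have := cardsD1 b (through i :\ a).
      rewrite in_setD1 eq_sym ab ai bi ci /= => -> -[E].
      apply: etrans (esym E); apply: eq_card => c.
      by rewrite !inE; case: (c == a); case: (c == b); rewrite ?andbF ?andbT.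
    rewrite -[X in X * _]c9 -sum_nat_const.
    by apply: leq_sum => c /andP[/andP[cB ca] _]; apply: ge2.
  have := ge2 b bi; rewrite eq_sym ab => /(_ isT).
  by move: #|A :&: col b| (\sum_(c | _) _) => x y; clear; lia.
have [ib jb] : i \in col b /\ j \in col b.
  by move: bij; rewrite !inE => /andP[/andP[_ ->] /andP[_ ->]].
rewrite (cardsD1 i) (cardsD1 j) !inE ia ib ja jb eq_sym ij /=.
suff -> : #|col a :&: col b :\ i :\ j| = 2 by [].
by rewrite -[RHS]ab2; apply: eq_card => o; rewrite !inE !andbA.
Qed.

Lemma special_uniq i j k :
  special i j -> i != k -> #|through i :&: through k| = 3 -> k = j.
Proof.
move=> [_ [deg5 _]] ik ci; apply/eqP/negPn/negP => kj.
by move: ci; rewrite deg5 // eq_sym.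
Qed.

Lemma special_disjoint i j k l : special i j -> special k l ->
  i != k -> j != l -> k != j -> i != l.
Proof.
move=> sij skl ik jl kj; apply/negP => /eqP il.
have := sij.2.1 k; rewrite eq_sym ik kj => /(_ isT isT).
by rewrite setIC il; case: skl => -[_ _ -> _].
Qed.

Lemma special_common i j k l : special i j -> special k l ->
  i != k -> j != l -> k != j ->
  #|through i :&: through j :&: through k| = 2 /\
  through i :&: through j :&: through k \subset through l.
Proof.
move=> sij skl ik jl kj; have il := special_disjoint sij skl ik jl kj.
have [[ij _ _ szi] _] := sij; have [[kl _ _ szk] [_ pair2]] := skl.
split; first by rewrite setIC setIA pair2 // eq_sym.
apply/subsetP => c /setIP[/setIP[ci cj] ck].
have jc : j \in col c by move: cj; rewrite inE => /andP[].
have := szk c ck; rewrite szi // jc; case: ifP => // lc _.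
by move: ck; rewrite !inE lc => /andP[->].
Qed.

Lemma special_common_rows i j k l : special i j -> special k l ->
  i != k -> j != l -> k != j ->
  exists a b, [/\ a != b,
    through i :&: through j :&: through k = [set a; b] &
    col a :&: col b = [set i; j; k; l]].
Proof.
move=> sij skl ik jl kj; have [X2 Xl] := special_common sij skl ik jl kj.
have il := special_disjoint sij skl ik jl kj.
have /cards2P[a [b [ab XE]]] : #|through i :&: through j :&: through k| == 2.
  by rewrite X2.
exists a, b; split=> //; apply/esym/eqP; rewrite eqEcard.
have inX c : c \in [set a; b] -> [/\ c \in through i :&: through j,
    i \in col c, j \in col c, k \in col c & l \in col c].
  rewrite -XE => cX; have := subsetP Xl c cX.
  case/setIP: cX => cij; have /setIP[] := cij.
  do 4!rewrite [c \in through _]inE => /andP[_ ?].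
  by split.
have [aij ia ja ka la] := inX a (set21 a b).
have [bij ib jb kb lb] := inX b (set22 a b).
rewrite (special_cap sij aij bij ab); apply/andP; split.
  by apply/subsetP => o; rewrite !inE => /orP[/orP[/orP[]|]|] /eqP->; apply/andP.
have [[ij _ _ _] _] := sij; have [[kl _ _ _] _] := skl.
by rewrite setUC cardsU1 setUC cardsU1 cards2 !inE !negb_or ij (eq_sym l)
  (eq_sym l) (eq_sym l) il jl kl (eq_sym k i) ik kj.
Qed.

Lemma special_same_partner i i' j k l : special i j -> special i' j ->
  special k l -> i != i' -> j != l -> k != j -> False.
Proof.
move=> sij si'j skl ii' jl kj.
have ik : i != k.
  apply: contraNneq jl => ik; apply/eqP; move: skl; rewrite -ik => sil.
  by apply: (special_uniq sil); case: sij => -[].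
have i'k : i' != k.
  apply: contraNneq jl => i'k; apply/eqP; move: skl; rewrite -i'k => sil.
  by apply: (special_uniq sil); case: si'j => -[].
have [X2 Xl] := special_common sij skl ik jl kj.
have [X2' Xl'] := special_common si'j skl i'k jl kj.
pose Y := through j :&: through k :&: through l.
have Y2 : #|Y| <= 2.
  have [[kl _ _ _] _] := skl; apply: no_three_through => //.
  by rewrite eq_sym.
have XY : through i :&: through j :&: through k = Y.
  apply/eqP; rewrite eqEcard X2 Y2 andbT; apply/subsetP => c cX.
  by have := subsetP Xl c cX; move: cX; rewrite !inE => /andP[/andP[_ ->] ->] ->.
have X'Y : through i' :&: through j :&: through k = Y.
  apply/eqP; rewrite eqEcard X2' Y2 andbT; apply/subsetP => c cX.
  by have := subsetP Xl' c cX; move: cX; rewrite !inE => /andP[/andP[_ ->] ->] ->.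
have [a [b [ab XE abE]]] := special_common_rows sij skl ik jl kj.
have : i' \in col a :&: col b.
  have h c : c \in [set a; b] -> i' \in col c.
    by rewrite -XE XY -X'Y !inE => /andP[/andP[/andP[_ ->]]].
  by rewrite inE !h ?set21 ?set22.
rewrite abE !inE (negPf i'k) (negPf (special_disjoint si'j skl i'k jl kj)).
have [[/negPf i'j _ _ _] _] := si'j.
by rewrite i'j eq_sym (negPf ii').
Qed.

Lemma no_two_mutual i j k l : special i j -> special j i -> special k l ->
  special l k -> i != k -> i != l -> j != k -> j != l -> False.
Proof.
move=> sij sji skl slk ik il jk jl.
have [[ij ci cij _] [degi _]] := sij; have [[_ cj _ _] [degj _]] := sji.
have [[kl ck ckl _] _] := skl; have [[_ cl _ _] _] := slk.
have kj : k != j by rewrite eq_sym.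
have [X2 Xl] := special_common sij skl ik jl kj.
pose X := through i :&: through j :&: through k.
have deg5 o o' : o \in [set i; j] -> o' \in [set k; l] ->
    #|(through o :&: through o') :\: X| = 3.
  move=> oij okl; have sub : X \subset through o :&: through o'.
    apply/subsetP => c cX; have cl' := subsetP Xl c cX; move: cX oij okl.
    rewrite !in_setI => /andP[/andP[? ?] ?].
    by case/set2P=> ->; case/set2P=> ->; apply/andP.
  rewrite cardsD (setIidPr sub) X2.
  suff -> : #|through o :&: through o'| = 5 by [].
  case/set2P: oij => ->; case/set2P: okl => ->;
  by [apply: degi; rewrite // eq_sym | apply: degj; rewrite // eq_sym].
have inter : #|(through i :|: through j) :&: (through k :|: through l)| <= 14.
  rewrite setIUl !setIUr.
  pose Y o o' := (through o :&: through o') :\: X.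
  apply: leq_trans (_ : #|X :|: (Y i k :|: Y i l :|: (Y j k :|: Y j l))| <= _).
    apply/subset_leq_card/subsetP => c; rewrite !in_setU !in_setD.
    by case: (c \in X) => //=; rewrite !in_setI.
  have cardU_le (A D : {set C}) : #|A :|: D| <= #|A| + #|D|.
    by rewrite cardsU leq_subr.
  have := cardU_le X (Y i k :|: Y i l :|: (Y j k :|: Y j l)).
  have := cardU_le (Y i k :|: Y i l) (Y j k :|: Y j l).
  have := cardU_le (Y i k) (Y i l); have := cardU_le (Y j k) (Y j l).
  rewrite /Y X2 !deg5 ?set21 ?set22 //.
  by move: #|_| #|_| #|_| #|_| => x y z t; clear; lia.
have := cardsU (through i) (through j); rewrite ci cj cij.
have := cardsU (through k) (through l); rewrite ck cl ckl.
have := cardsUI (through i :|: through j) (through k :|: through l).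
have := max_card (mem (through i :|: through j :|: (through k :|: through l))).
rewrite cardC; move: inter.
move: #|_| #|_| #|_| #|_| => x y z t; clear; lia.
Qed.

Definition heavy : {set R} := [set i | 480 < row_weight i].
Definition partner (i : R) : R :=
  odflt i [pick j | (j != i) && (#|through i :&: through j| == 3)].

Lemma heavy_special i : i \in heavy -> special i (partner i).
Proof.
rewrite inE => /row_weight_special[j sij]; rewrite /partner.
case: pickP => [k /andP[ki /eqP ci]|/(_ j)] /=.
  by rewrite (special_uniq sij _ ci) // eq_sym.
by have [[ij _ -> _] _] := sij; rewrite eq_sym ij.
Qed.

Lemma special_row_weight i j : special i j -> row_weight i = 500.
Proof.
move=> [[ij ci cij sz] _]; rewrite /row_weight.
rewrite (eq_bigr (fun c => 40 + 20 * (j \in col c))).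
  rewrite big_split sum_nat_const ci -big_distrr /= -[500]/(11 * 40 + 20 * 3).
  suff -> : \sum_(c in through i) (j \in col c) = 3 by [].
  rewrite -[RHS]cij -sum1_card big_mkcond [RHS]big_mkcond /=.
  apply: eq_bigr => c _; rewrite !inE.
  by case: (4 < _); case: (i \in _); case: (j \in _).
by move=> c /sz ->; case: (j \in col c).
Qed.

Lemma row_weight_le i : row_weight i <= 480 + 20 * (i \in heavy).
Proof.
case hi: (i \in heavy).
  by rewrite (special_row_weight (heavy_special hi)).
by move: hi; rewrite inE addn0 => /negbT; rewrite -leqNgt.
Qed.

Lemma sum_row_weight : 13 * 480 + 120 <= \sum_i row_weight i.
Proof.
have -> : \sum_i row_weight i = \sum_c #|col c| * weight #|col c|.-1.
  rewrite /row_weight.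
  rewrite (eq_bigr (fun i => \sum_c (i \in col c) * weight #|col c|.-1)).
    rewrite exchange_big; apply: eq_bigr => c _ /=.
    rewrite -big_distrl -sum1_card; congr (_ * _).
    by rewrite [RHS]big_mkcond.
  move=> i _; rewrite big_mkcond; apply: eq_bigr => c _; rewrite inE.
  case: ltnP => h /=; first by case: (i \in col c); rewrite ?mul1n.
  have -> : weight #|col c|.-1 = 0 by case: #|_| h => [|[|[|[|[|]]]]].
  by rewrite muln0.
have : \sum_c 180 * #|col c| <= \sum_c (#|col c| * weight #|col c|.-1 + 840).
  by apply: leq_sum => c _; apply: weight_line; rewrite -cardR max_card.
rewrite -big_distrr big_split sum_nat_const cardC /= => h.
have h2 := leq_mul (leqnn 180) ones.
by move: h h2; move: (\sum_c _) (\sum_c _) => x y; clear; lia.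
Qed.

Lemma heavy_ge6 : 5 < #|heavy|.
Proof.
have : \sum_i row_weight i <= \sum_i (480 + 20 * (i \in heavy)).
  by apply: leq_sum => i _; apply: row_weight_le.
rewrite big_split sum_nat_const cardR -big_distrr /=.
have -> : \sum_i (i \in heavy : nat) = #|heavy| by rewrite -sum1_card [RHS]big_mkcond.
have := sum_row_weight; move: (\sum_i _) #|heavy| => x y; clear; lia.
Qed.

(* If all heavy rows had distinct partners, then each heavy row [k] unrelated to
   a fixed one [i] would single out two of the three columns common to [i] and
   [partner i], and these pairs are all distinct. *)
Lemma partner_not_injective : ~ {in heavy &, injective partner}.
Proof.
move=> inj.
have partner_inv i : i \in heavy -> partner i \in heavy ->
    partner (partner i) = i.
  move=> /heavy_special sij /heavy_special sjk; apply/esym.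
  have [[ij _ cij _] _] := sij.
  by apply: (special_uniq sjk); rewrite 1?eq_sym // setIC.
have [i hi nonmutual] : exists2 i, i \in heavy &
    forall k, k \in heavy -> k != i -> k != partner i -> partner k \notin heavy.
  have [/exists_inP[i hi hpi]|] := boolP [exists i in heavy, partner i \in heavy].
    exists i => // k hk ki kpi; apply/negP => hpk.
    have sij := heavy_special hi; have sji := heavy_special hpi.
    have skl := heavy_special hk; have slk := heavy_special hpk.
    rewrite partner_inv // in sji; rewrite partner_inv // in slk.
    apply: (no_two_mutual sij sji skl slk); rewrite // 1?eq_sym //.
      by apply: contraNneq kpi => <-; rewrite partner_inv.
    by apply: contraNneq ki => /inj ->.
  rewrite negb_exists_in => /forall_inP h.
  have /card_gt0P[i hi] : 0 < #|heavy| by apply: leq_trans heavy_ge6.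
  by exists i => // k hk _ _; apply: h.
have sij := heavy_special hi; set j := partner i in sij nonmutual.
pose Q := heavy :\ i :\ j.
have Q4 : 3 < #|Q|.
  have := heavy_ge6; rewrite (cardsD1 i) hi (cardsD1 j (heavy :\ i)).
  by move: #|heavy :\ i :\ j|; case: (j \in _); rewrite /Q => q; lia.
have inQ k : k \in Q -> [/\ k \in heavy, special k (partner k), i != k,
                          j != partner k & k != j].
  rewrite !inE => /and3P[kj ki hk].
  have hk' : k \in heavy by rewrite inE.
  split=> //; first exact: heavy_special.
    by rewrite eq_sym.
  by apply: contraNneq ki => /(inj _ _ hi hk') ->.
pose f k := (through i :&: through j) :\: through k.
have f1 k : k \in Q -> #|f k| = 1.
  move=> /inQ[_ skl ik jl kj]; rewrite cardsD.
  by have [-> _] := special_common sij skl ik jl kj; case: sij => [[_ _ ->]].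
have f_inj : {in Q &, injective f}.
  move=> k k' kQ k'Q fE.
  have [hk skl ik jl kj] := inQ k kQ; have [hk' skl' ik' jl' kj'] := inQ k' k'Q.
  have XE : through i :&: through j :&: through k =
            through i :&: through j :&: through k'.
    have DE (A D : {set C}) : A :&: D = A :\: (A :\: D).
      by rewrite setDDr setDv set0U.
    by rewrite [LHS]DE [RHS]DE -/(f k) fE.
  have [a [b [ab Xab abE]]] := special_common_rows sij skl ik jl kj.
  have : k' \in col a :&: col b.
    have h c : c \in [set a; b] -> k' \in col c.
      by rewrite -Xab XE !in_setI => /andP[_]; rewrite inE => /andP[].
    by rewrite in_setI !h ?set21 ?set22.
  rewrite abE !inE eq_sym (negPf ik') (negPf kj') /= => /orP[/eqP //|/eqP k'l].
  have := nonmutual k hk; rewrite eq_sym ik kj -k'l hk'.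
  by move=> /(_ isT isT).
have := card_in_imset f_inj.
have : f @: Q \subset [set A : {set C} | (A \subset through i :&: through j) &
                                        (#|A| == 1)].
  apply/subsetP => _ /imsetP[k kQ ->]; rewrite inE f1 // eqxx andbT.
  exact: subsetDl.
move=> /subset_leq_card; rewrite cards_draws.
have [[_ _ -> _] _] := sij; rewrite bin1 => le3 E.
by move: le3; rewrite E leqNgt Q4.
Qed.

Lemma common_partner : exists j, forall i, i \in heavy -> special i j.
Proof.
have [i1 [i2 [h1 h2 ne pE]]] : exists i1 i2, [/\ i1 \in heavy, i2 \in heavy,
    i1 != i2 & partner i1 = partner i2].
  have [/exists_inP[i1 h1 /exists_inP[i2 h2 /andP[ne /eqP pE]]]|] := boolP
      [exists i1 in heavy, exists i2 in heavy,
        (i1 != i2) && (partner i1 == partner i2)].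
    by exists i1, i2.
  rewrite negb_exists_in => /forall_inP h; case: partner_not_injective.
  move=> i1 i2 h1 h2 pE; apply/eqP; apply: contraT => ne.
  have := h i1 h1; rewrite negb_exists_in => /forall_inP /(_ i2 h2).
  by rewrite ne pE eqxx.
exists (partner i1) => k hk; have skl := heavy_special hk.
have s1 := heavy_special h1; have := heavy_special h2; rewrite -pE => s2.
have [-> //|jl] := eqVneq (partner i1) (partner k).
have [kj|kj] := eqVneq k (partner i1); last first.
  by case: (special_same_partner s1 s2 skl ne jl kj).
have follower i : special i (partner i1) -> i = partner k.
  move=> [[ij _ ci _] _]; apply: (special_uniq skl); first by rewrite kj eq_sym.
  by rewrite kj setIC.
by move: ne; rewrite (follower i1 s1) (follower i2 s2) eqxx.
Qed.

Lemma row_weight_pairs j :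
  row_weight j <= \sum_(o | o != j)
    \sum_(c in through j :&: through o) 2 * #|col c|.-2.
Proof.
apply: leq_trans (_ : \sum_(c in through j) \sum_(o | o != j)
   (o \in col c) * (2 * #|col c|.-2) <= _).
  apply: leq_sum => c; rewrite inE => /andP[_ jc].
  rewrite -big_distrl; apply: leq_trans (weight_le _) _ => /=.
  rewrite mulnCA leq_mul2r (cardsD1 j) jc -sum1_card big_mkcond.
  rewrite [X in _ <= X]big_mkcond; apply/orP; right; apply: leq_sum => o _.
  by rewrite !inE; case: (o == j); case: (o \in col c).
rewrite exchange_big; apply: leq_sum => o oj /=.
rewrite big_mkcond [X in _ <= X]big_mkcond; apply: leq_sum => c _.
rewrite !inE; case: (4 < _); case: (j \in _); case: (o \in _) => //=.
by rewrite mul1n.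
Qed.

Lemma pair_weight_le j o : o != j ->
  \sum_(c in through j :&: through o) 2 * #|col c|.-2 <= 44.
Proof.
move=> oj; rewrite -big_distrr -[44]/(2 * 22) leq_mul2l /=.
pose A := [set~ j] :\ o.
apply: leq_trans (_ : \sum_(c in through j :&: through o) #|A :&: col c| <= _).
  apply: leq_sum => c; rewrite !inE => /andP[/andP[_ jc] /andP[_ oc]].
  rewrite (cardsD1 j) jc (cardsD1 o) !inE oj oc /=.
  by apply/subset_leq_card/subsetP => x; rewrite !inE => /and3P[-> -> ->].
rewrite card_row_cap; last by move=> c; rewrite !inE => /andP[/andP[]].
have A11 : #|A| = 11.
  by have := cardsD1 o [set~ j]; rewrite cardsC1 cardR !inE oj => -[].
apply: leq_trans (_ : \sum_(x in A) 2 <= _).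
  apply: leq_sum => x; rewrite !inE => /andP[xo xj].
  by apply: no_three_through; rewrite eq_sym.
by rewrite sum_nat_const A11.
Qed.

Lemma all_special j : (forall i, i \in heavy -> special i j) ->
  forall i, i != j -> special i j.
Proof.
move=> hj.
have jh : j \notin heavy by apply/negP => /hj[[/eqP]].
have Wj : row_weight j <= \sum_(o | o != j) (44 - 14 * (o \in heavy)).
  apply: leq_trans (row_weight_pairs j) _; apply: leq_sum => o oj.
  case oh: (o \in heavy); last exact: pair_weight_le.
  have [[_ _ co sz] _] := hj o oh.
  rewrite (eq_bigr (fun=> 10)); first by rewrite sum_nat_const setIC co.
  move=> c; rewrite !inE => /andP[/andP[c4 jc] /andP[_ oc]].
  by rewrite sz ?jc // inE c4.
have : \sum_i row_weight i <=
       \sum_(o | o != j) (524 + 6 * (o \in heavy)).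
  rewrite (bigD1 j) //=; apply: leq_trans (leq_add Wj (leqnn _)) _.
  rewrite -big_split; apply: leq_sum => o _ /=.
  by have := row_weight_le o; case: (o \in heavy) => /=; lia.
move=> /(leq_trans sum_row_weight).
rewrite big_split sum_nat_const -big_distrr /=.
have -> : #|[pred o | o != j]| = 12.
  by have := cardC1 j; rewrite cardR /= => E; apply: etrans E; apply: eq_card.
have -> : \sum_(o | o != j) (o \in heavy : nat) = #|heavy|.
  rewrite -sum1_card [LHS]big_mkcond [RHS]big_mkcond; apply: eq_bigr => o _.
  by case: eqP => [->|_]; rewrite ?(negPf jh) //; case: (o \in heavy).
move=> h12 i ij; apply: hj.
have /eqP hE : heavy == [set~ j].
  rewrite eqEcard cardsC1 cardR; apply/andP; split.
    by apply/subsetP => o oh; rewrite !inE; apply: contraNneq jh => <-.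
  by move: h12; move: #|heavy| => x; clear; lia.
by rewrite hE !inE.
Qed.

Theorem no_dense_columns : False.
Proof.
have [j hj] := common_partner; have sp := all_special hj.
pose V := through j.
have meet o c : o != j -> c \in V -> o \in col c -> c \in through o :&: V.
  by move=> oj cV oc; rewrite in_setI cV andbT inE oc andbT; move: cV; rewrite inE => /andP[].
have size7 c : c \in V -> #|col c :\ j| = 6.
  rewrite inE => /andP[c4 jc].
  have /card_gt0P[o] : 0 < #|col c :\ j|.
    by move: c4; rewrite (cardsD1 j) jc; case: #|_|.
  rewrite !inE => /andP[oj oc]; have [[_ _ _ sz] _] := sp o oj.
  have := sz c; rewrite inE c4 oc jc => /(_ isT).
  by rewrite (cardsD1 j) jc => -[].
have deg3 o : o != j -> #|V :&: through o| = 3.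
  by move=> oj; have [[_ _ <- _] _] := sp o oj; rewrite setIC.
have V4 c : c \in V -> 4 < #|col c| by rewrite inE => /andP[].
have cardV : #|V| = 6.
  have : \sum_(c in V) #|[set~ j] :&: col c| = 36.
    rewrite card_row_cap // (eq_bigr (fun=> 3)).
      by rewrite sum_nat_const cardsC1 cardR.
    by move=> o; rewrite !inE => /deg3.
  rewrite (eq_bigr (fun=> 6)) ?sum_nat_const; first by move: #|V| => x; clear; lia.
  move=> c /size7 <-; apply: eq_card => o; by rewrite !inE.
pose M a b := #|(col a :\ j) :&: col b|.
have MC a b : a \in V -> b \in V -> M a b = M b a.
  move=> _ _; apply: eq_card => o; rewrite !inE.
  by case: (o == j); case: (o \in col a); case: (o \in col b).
have M03 a b : a \in V -> b \in V -> a != b -> (M a b == 0) || (M a b == 3).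
  move=> aV bV ab; rewrite -implyNb -lt0n; apply/implyP => /card_gt0P[o].
  rewrite !inE => /andP[/andP[oj oa] ob].
  have := special_cap (sp o oj) (meet o a oj aV oa) (meet o b oj bV ob) ab.
  have jj : j \in col a :&: col b.
    by move: aV bV; rewrite !inE => /andP[_ ->] /andP[_ ->].
  rewrite (cardsD1 j) jj => -[<-]; apply/eqP; apply: eq_card => x.
  by rewrite !inE andbA.
have sumM a : a \in V -> \sum_(b in V | b != a) M a b = 12.
  move=> aV; have : \sum_(b in V) M a b = 18.
    rewrite card_row_cap // (eq_bigr (fun=> 3)) ?sum_nat_const ?size7 //.
    by move=> o; rewrite !inE => /andP[/deg3].
  rewrite (bigD1 a) //= /M (setIidPl (subD1set _ _)) size7 //.
  by move: (\sum_(b in V | _) _) => x; clear; lia.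
have apart_count a : a \in V -> \sum_(b in V | b != a) (M a b == 0) = 1.
  move=> aV; have : 3 * \sum_(b in V | b != a) (M a b == 0) +
      \sum_(b in V | b != a) M a b = 5 * 3.
    rewrite -[5]/(6.-1) -cardV -(card_rem aV) -sum_nat_const big_distrr -big_split.
    apply: eq_bigr => b /andP[bV ba] /=.
    by have := M03 a b aV bV; rewrite eq_sym ba => /(_ isT) /orP[] /eqP->.
  rewrite sumM //; move: (\sum_(b in V | _) _) => x; clear; lia.
have ex_apart a : a \in V -> exists2 g, g \in V & g != a /\ M a g = 0.
  move=> aV; have := apart_count a aV => aE.
  have [/exists_inP[g gV /andP[ga /eqP gM]]|] :=
    boolP [exists g in V, (g != a) && (M a g == 0)]; first by exists g.
  rewrite negb_exists_in => /forall_inP h; move: aE; rewrite big1 //.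
  by move=> b /andP[bV ba]; have := h b bV; rewrite ba /= => /negPf->.
have apart_uniq a g g' : a \in V -> g \in V -> g' \in V -> g != a -> g' != a ->
    M a g = 0 -> M a g' = 0 -> g = g'.
  move=> aV gV g'V ga g'a ag ag'; apply/eqP; apply: contraT => gg'.
  have := apart_count a aV; rewrite (bigD1 g) ?gV //= (bigD1 g') /=; last first.
    by rewrite g'V g'a eq_sym.
  by rewrite ag ag'.
have /card_gt0P[o] : 0 < #|[set~ j]| by rewrite cardsC1 cardR.
rewrite !inE => oj.
have /card_gt1P[a [b [aVo bVo ab]]] : 1 < #|V :&: through o| by rewrite deg3.
have [aV oa] := setIP aVo; have [bV ob] := setIP bVo.
have Mab : M a b = 3.
  have := M03 a b aV bV ab; case/orP => /eqP // /eqP; rewrite cards_eq0.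
  by move/eqP/setP/(_ o); move: oa ob; rewrite !inE oj => /andP[_ ->] /andP[_ ->].
pose D := (col a :\ j) :&: col b.
have D_le1 c : c \in V -> c != a -> c != b -> #|D :&: col c| <= 1.
  move=> cV ca cb; have := no_three_cols ab; move=> /(_ c).
  rewrite eq_sym ca eq_sym cb => /(_ isT isT).
  have jj : j \in col a :&: col b :&: col c.
    by move: aV bV cV; rewrite !inE => /andP[_ ->] /andP[_ ->] /andP[_ ->].
  rewrite (cardsD1 j) jj add1n ltnS => h; apply: leq_trans h.
  by apply/subset_leq_card/subsetP => x; rewrite !inE => /andP[/andP[/andP[-> ->] ->] ->].
have D_sum : \sum_(c in V | (c != a) && (c != b)) #|D :&: col c| = 3.
  have : \sum_(c in V) #|D :&: col c| = 9.
    rewrite card_row_cap // (eq_bigr (fun=> 3)) ?sum_nat_const -?/(M a b) ?Mab //.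
    by move=> x; rewrite !inE => /andP[/andP[/deg3]].
  rewrite (bigD1 a) //= (bigD1 b) /=; last by rewrite bV eq_sym.
  have -> : D :&: col a = D.
    by apply/setIidPl/subsetP => x; rewrite !inE => /andP[/andP[_ ->]].
  have -> : D :&: col b = D by apply/setIidPl/subsetP => x; rewrite !inE => /andP[_].
  rewrite -/(M a b) Mab; under [in X in X -> _]eq_bigl do rewrite -andbA.
  by move: (\sum_(c in V | _) _) => x; clear; lia.
have D_zero c c' : c \in V -> c' \in V -> c != a -> c != b -> c' != a ->
    c' != b -> #|D :&: col c| = 0 -> #|D :&: col c'| = 0 -> c = c'.
  move=> cV c'V ca cb c'a c'b c0 c'0; apply/eqP; apply: contraT => cc'.
  have : \sum_(c in V | (c != a) && (c != b)) (1 - #|D :&: col c|) +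
         \sum_(c in V | (c != a) && (c != b)) #|D :&: col c| = 4.
    have V4' : #|[pred c in V | (c != a) && (c != b)]| = 4.
      have := cardsD1 a V; have := cardsD1 b (V :\ a).
      rewrite in_setD1 eq_sym ab aV bV cardV /= => -> -[E].
      apply: etrans (esym E); apply: eq_card => d.
      by rewrite !inE; case: (d == a); case: (d == b); rewrite ?andbF ?andbT.
    rewrite -big_split -[RHS]muln1 -[X in X * 1]V4' -sum_nat_const /=.
    by apply: eq_bigr => d /and3P[dV da db]; rewrite subnK // D_le1.
  rewrite D_sum (bigD1 c) ?cV ?ca //= c0 (bigD1 c') /= ?c'0; last first.
    by rewrite c'V c'a c'b eq_sym.
  by move: (\sum_(_ | _) _) => x h; exfalso; move: h; clear; lia.
have [g gV [ga ag0]] := ex_apart a aV; have [g' g'V [g'b bg0]] := ex_apart b bV.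
have gb : g != b by apply/eqP => gb; move: ag0; rewrite gb Mab.
have g'a : g' != a by apply/eqP => gb'; move: bg0; rewrite gb' MC // Mab.
have gg' : g = g'.
  apply: D_zero => //; apply/eqP; rewrite -leqn0.
    rewrite -ag0; apply/subset_leq_card/subsetP => x.
    by rewrite !inE => /andP[/andP[-> _] ->].
  rewrite -bg0; apply/subset_leq_card/subsetP => x.
  by rewrite !inE => /andP[/andP[/andP[-> _] ->] ->].
move: ab; rewrite (apart_uniq g a b) ?eqxx // 1?eq_sym // MC //.
by rewrite gg'.
Qed.

End Columns.

(** * The Zarankiewicz number *)

Lemma nb_ones_cols m n (A : 'M[bool]_(m, n)) :
  nb_ones A = \sum_c #|[set i | A i c]|.
Proof.
rewrite /nb_ones -sum1_card big_mkcond /=.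
rewrite (eq_bigr (fun ij : 'I_m * 'I_n => (A ij.1 ij.2 : nat))); last first.
  by move=> ij _; rewrite inE; case: (A _ _).
rewrite -(pair_bigA _ (fun i j => (A i j : nat))) exchange_big /=.
apply: eq_bigr => c _; rewrite -sum1_card [RHS]big_mkcond /=.
by apply: eq_bigr => i _; rewrite inE; case: (A _ _).
Qed.

Lemma nb_ones_le137 (A : 'M[bool]_(13, 22)) :
  ~ has_all_one_submx 3 3 A -> nb_ones A <= 137.
Proof.
move=> hA; rewrite leqNgt; apply/negP => h.
apply: (@no_dense_columns _ _ (fun c => [set i | A i c])).
- exact: card_ord.
- exact: card_ord.
- move=> i j k ij ik jk; rewrite leqNgt; apply/card_gt2P.
  move=> [x [y [z [[xA yA zA] [xy yz zx]]]]]; apply: hA.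
  exists (tnth [tuple i; j; k]), (tnth [tuple x; y; z]); split.
  + by apply/tuple_uniqP; rewrite /= !inE negb_or ij ik jk.
  + by apply/tuple_uniqP; rewrite /= !inE negb_or xy yz eq_sym zx.
  apply/matrixP => a b; rewrite !mxE.
  have /allP /(_ _ (mem_tnth a [tuple i; j; k])) /allP /(_ _ (mem_tnth b [tuple x; y; z])) // :
    all (fun p => all (fun q => A p q) [tuple x; y; z]) [tuple i; j; k].
  by move: xA yA zA; rewrite !inE /= => /and3P[-> -> ->] /and3P[-> -> ->] /and3P[-> -> ->].
- by rewrite -nb_ones_cols.
Qed.

Lemma has_Kst_copyP s t m n (E : {set 'I_m * 'I_n}) (r : 'I_s -> 'I_m)
    (c : 'I_t -> 'I_n) :
  injective r -> injective c -> (forall a b, (r a, c b) \in E) ->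
  has_Kst_copy s t E.
Proof.
move=> r_inj c_inj rcE; apply/existsP.
exists [ffun x => match x with inl a => inl (r a) | inr b => inr (c b) end].
apply/andP; split.
  apply/injectiveP => -[a|b] [a'|b']; rewrite !ffunE //.
    by move=> -[/r_inj->].
  by move=> -[/c_inj->].
by apply/forallP => -[a|b]; apply/forallP => -[a'|b']; rewrite !ffunE /= ?rcE ?implybT.
Qed.

Lemma K33_copy_rows_cols m n (E : {set 'I_m * 'I_n}) : has_Kst_copy 3 3 E ->
  exists (r : 'I_3 -> 'I_m) (c : 'I_3 -> 'I_n),
    [/\ injective r, injective c & forall a b, (r a, c b) \in E].
Proof.
case/existsP => f /andP[/injectiveP f_inj /forallP fE].
have adj a b : bip_adj E (f (inl a)) (f (inr b)).
  by have /forallP /(_ (inr b)) := fE (inl a); rewrite /= inE.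
case f0: (f (inl ord0)) => [i0|j0].
  have hc b : exists j, f (inr b) = inr j.
    by have := adj ord0 b; rewrite f0; case: (f (inr b)) => // j _; exists j.
  have [c fc] := fin_all_exists hc.
  have hr a : exists i, f (inl a) = inl i.
    by have := adj a ord0; rewrite fc; case: (f (inl a)) => // i _; exists i.
  have [r fr] := fin_all_exists hr.
  exists r, c; split=> [a a' e|b b' e|a b].
  - by have /f_inj[] : f (inl a) = f (inl a') by rewrite !fr e.
  - by have /f_inj[] : f (inr b) = f (inr b') by rewrite !fc e.
  - by have := adj a b; rewrite fr fc.
have hr b : exists i, f (inr b) = inl i.
  by have := adj ord0 b; rewrite f0; case: (f (inr b)) => // i _; exists i.
have [r fr] := fin_all_exists hr.
have hc a : exists j, f (inl a) = inr j.
  by have := adj a ord0; rewrite fr; case: (f (inl a)) => // j _; exists j.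
have [c fc] := fin_all_exists hc.
exists r, c; split=> [a a' e|b b' e|a b].
- by have /f_inj[] : f (inr a) = f (inr a') by rewrite !fr e.
- by have /f_inj[] : f (inl b) = f (inl b') by rewrite !fc e.
- by have := adj b a; rewrite fr fc.
Qed.

Definition indicator (E : {set 'I_13 * 'I_22}) : 'M[bool]_(13, 22) :=
  \matrix_(i, j) ((i, j) \in E).

Lemma nb_ones_indicator E : nb_ones (indicator E) = #|E|.
Proof. by apply: eq_card => -[i j]; rewrite inE mxE. Qed.

(* Rows 0 to 11 are the points of the Hadamard 3-(12, 6, 2) design: columns
   [2 s] and [2 s + 1] are the translate by [s] of the squares modulo 11, with
   the point at infinity 11 added, and its complement. Row 12 lies in five
   blocks, no three of which share two points. *)
Definition extended_design (i c : nat) : bool :=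
  if i == 12 then c \in [:: 0; 2; 5; 10; 13]
  else if i == 11 then ~~ odd c
  else odd c (+) ((i + 11 - c./2) %% 11 \in [:: 1; 3; 4; 5; 9]).

Definition design_table : seq (seq bool) :=
  [seq [seq extended_design i c | c <- iota 0 22] | i <- iota 0 13].

Definition entry (T : seq (seq bool)) i c := nth false (nth [::] T i) c.

Definition three_rows_ok (T : seq (seq bool)) : bool :=
  all (fun i => all (fun j => all (fun k =>
    [|| i == j, i == k, j == k |
        count (fun c => [&& entry T i c, entry T j c & entry T k c])
              (iota 0 22) <= 2])
   (iota 0 13)) (iota 0 13)) (iota 0 13).

Lemma design_three_rows : three_rows_ok design_table.
Proof. by vm_compute. Qed.

Definition design_edges : {set 'I_13 * 'I_22} :=
  [set ij : 'I_13 * 'I_22 | entry design_table ij.1 ij.2].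

Lemma card_design_edges : #|design_edges| = 137.
Proof.
rewrite -sum1_card big_mkcond /=.
rewrite (eq_bigr (fun ij : 'I_13 * 'I_22 => (entry design_table ij.1 ij.2 : nat))).
  rewrite -(pair_bigA _ (fun (i : 'I_13) (j : 'I_22) => (entry design_table i j : nat))) /=.
  rewrite -(big_mkord xpredT (fun i => \sum_(j < 22) entry design_table i j)).
  under eq_bigr => i _ do rewrite -(big_mkord xpredT (fun j => entry design_table i j : nat)).
  by rewrite unlock; vm_compute.
by move=> ij _; rewrite inE; case: (entry _ _ _).
Qed.

Lemma design_K33_free : ~~ has_Kst_copy 3 3 design_edges.
Proof.
apply/negP => /K33_copy_rows_cols[r [c [r_inj c_inj rcE]]].
pose i a : nat := r a; have iP a : i a \in iota 0 13 by rewrite mem_iota ltn_ord.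
have ne a a' : a != a' -> (i a == i a') = false.
  by move=> aa'; apply: contraNF aa' => /eqP /ord_inj /r_inj ->.
have /allP /(_ _ (iP ord0)) /allP /(_ _ (iP (inord 1))) /allP
     /(_ _ (iP (inord 2))) := design_three_rows.
do 3![rewrite ne ?orFb; last by rewrite -val_eqE /= !inordK].
apply/negP; rewrite -ltnNge -size_filter.
have s3 : size [seq (c b : nat) | b <- enum 'I_3] = 3.
  by rewrite size_map size_enum_ord.
rewrite -[X in X <= _]s3.
apply: uniq_leq_size.
  by rewrite map_inj_uniq ?enum_uniq // => b b' /ord_inj /c_inj.
move=> _ /mapP[b _ ->]; rewrite mem_filter mem_iota ltn_ord andbT.
have h a : entry design_table (i a) (c b) by have := rcE a b; rewrite inE.
by rewrite !h.
Qed.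

Theorem theorem1p2 :
  (~ exists A : 'M[bool]_(13, 22),
       nb_ones A = 138 /\ ~ has_all_one_submx 3 3 A)
  /\ zarankiewicz 13 22 3 3 = 137.
Proof.
split=> [[A [A138 /nb_ones_le137]]|]; first by rewrite A138.
apply/eqP; rewrite eqn_leq; apply/andP; split.
  apply/bigmax_leqP => E EK; rewrite -nb_ones_indicator.
  apply: nb_ones_le137 => -[r [c [r_inj c_inj /matrixP rcE]]].
  case/negP: EK; apply: has_Kst_copyP r_inj c_inj _ => a b.
  by have := rcE a b; rewrite !mxE.
rewrite -[X in X <= _]card_design_edges.
exact: (leq_bigmax_cond (F := fun E : {set 'I_13 * 'I_22} => #|E|) _
          design_K33_free).
Qed.
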